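(* In the remote setting, let $\Delta_{\mathrm{rem}}(R)=D_e^{(\mathrm{rem})}(R)-D_\infty^{\mathrm{rem}}$ be the excess distortion above the infinite-rate remote baseline, i.e. the minimum of $\mathrm{tr}(QK_\Theta)$ over symmetric $K_\Theta$ with $0\prec K_\Theta\preceq\Sigma_\Theta$ and $\frac12\log\frac{\det\Sigma_\Theta}{\det K_\Theta}\le R$. Assume $Q\succ0$ and that there is an orthogonal $U$ with $$U^\top\Sigma_\Theta U=\mathrm{diag}(\sigma_{\Theta,1}^2,\dots,\sigma_{\Theta,k}^2),\qquad U^\top QU=\mathrm{diag}(q_1,\dots,q_k),\quad q_i>0.$$ Then an optimal posterior covariance is $K_\Theta^\star(R)=U\,\mathrm{diag}(k_1^\star(R),\dots,k_k^\star(R))\,U^\top$ with $$k_i^\star(R)=\min\left\{\sigma_{\Theta,i}^2,\ \frac{\nu^\star(R)}{q_i}\right\},$$ where $\nu^\star(R)>0$ is chosen so that $\sum_{i=1}^k\log\frac{\sigma_{\Theta,i}^2}{k_i^\star(R)}=2R$. In the interior regime, where $k_i^\star(R)<\sigma_{\Theta,i}^2$ for all $i$, one has $K_\Theta^\star(R)=\nu^\star(R)\,Q^{-1}$ with $$\nu^\star(R)=\exp\!\left(\frac1k\left[\sum_{i=1}^k\log\big(q_i\sigma_{\Theta,i}^2\big)-2R\right]\right),$$ and $\Delta_{\mathrm{rem}}(R)=\mathrm{tr}(QK_\Theta^\star(R))=k\,\nu^\star(R)$.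
   Context: $k\ge1$, $R\ge0$; $B\in\mathbb R^{k\times k}$; $\Sigma_X\succ0$, $\Sigma_V\succeq0$, $W_e\succ0$ symmetric $k\times k$. $X\sim\mathcal N(0,\Sigma_X)$ and $V\sim\mathcal N(0,\Sigma_V)$ are independent, $\Theta=BX+V$, $\Sigma_\Theta=B\Sigma_XB^\top+\Sigma_V\succ0$, $L_X=\Sigma_XB^\top\Sigma_\Theta^{-1}$, $L_V=\Sigma_V\Sigma_\Theta^{-1}$, $\tilde W=W_e(B-I)+(B-I)^\top W_e+W_e$, and $$Q=L_X^\top\tilde WL_X+L_X^\top W_eL_V+L_V^\top W_eL_X.$$ $D_e^{(\mathrm{rem})}(R)$ is the minimal encoder distortion (mean of $(\Theta-\hat X)^\top W_e(\Theta-\hat X)$ with $\hat X$ the conditional mean of $X$ given the message) achievable at rate $R$ when the encoder observes only $\Theta$, and $D_\infty^{\mathrm{rem}}=\mathbb E[(\Theta-\mathbb E[X\mid\Theta])^\top W_e(\Theta-\mathbb E[X\mid\Theta])]$. By the remote rate--distortion characterization, $D_e^{(\mathrm{rem})}(R)-D_\infty^{\mathrm{rem}}$ equals the minimum displayed in the claim. Logarithms are natural; $\preceq$ is the Loewner order. *)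

(* Defs.v *)
From HB Require Import structures.
From mathcomp Require Import all_boot all_order all_algebra.
From mathcomp Require Import all_classical all_reals.
From mathcomp Require Import sequences exp.

Set Implicit Arguments.
Unset Strict Implicit.
Unset Printing Implicit Defensive.

Import Order.TTheory GRing.Theory Num.Theory.
Local Open Scope classical_set_scope.
Local Open Scope ring_scope.

(* Over the reals the quadratic form does not see the antisymmetric part, so
   symmetry is part of both definitions. *)
Definition psd_mx (R : realType) (k : nat) (A : 'M[R]_k) : Prop :=
  A^T = A /\ forall x : 'cV[R]_k, 0 <= (x^T *m A *m x) 0 0.

Definition pd_mx (R : realType) (k : nat) (A : 'M[R]_k) : Prop :=
  A^T = A /\ forall x : 'cV[R]_k, x != 0 -> 0 < (x^T *m A *m x) 0 0.

Definition loewner_le (R : realType) (k : nat) (A B : 'M[R]_k) : Prop :=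
  psd_mx (B - A).

Section Model.
Context (R : realType) (k : nat).
Implicit Types B SigmaX SigmaV We Q K SigmaT : 'M[R]_k.

(* Theta = B X + V with X ~ N(0, SigmaX) and V ~ N(0, SigmaV) independent; the
   model enters only through the covariance of Theta and the matrices L_X, L_V
   of the conditional means E[X | Theta] = L_X Theta, E[V | Theta] = L_V Theta. *)
Definition Sigma_Theta B SigmaX SigmaV : 'M[R]_k :=
  B *m SigmaX *m B^T + SigmaV.

Definition L_X B SigmaX SigmaV : 'M[R]_k :=
  SigmaX *m B^T *m invmx (Sigma_Theta B SigmaX SigmaV).

Definition L_V B SigmaX SigmaV : 'M[R]_k :=
  SigmaV *m invmx (Sigma_Theta B SigmaX SigmaV).

Definition W_tilde B We : 'M[R]_k :=
  We *m (B - 1%:M) + (B - 1%:M)^T *m We + We.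

Definition Q_rem B SigmaX SigmaV We : 'M[R]_k :=
  let LX := L_X B SigmaX SigmaV in
  let LV := L_V B SigmaX SigmaV in
  LX^T *m W_tilde B We *m LX + LX^T *m We *m LV + LV^T *m We *m LX.

Definition rem_feasible SigmaT (r : R) : set 'M[R]_k :=
  [set K | [/\ pd_mx K, loewner_le K SigmaT
             & 2^-1 * ln (\det SigmaT / \det K) <= r]].

Definition rem_optimal Q SigmaT (r : R) K : Prop :=
  rem_feasible SigmaT r K /\
  forall K', rem_feasible SigmaT r K' -> \tr (Q *m K) <= \tr (Q *m K').

(* The excess distortion above the infinite-rate remote baseline, in the form
   given by the remote rate-distortion characterization.  The infimum is a
   minimum as soon as some K satisfies [rem_optimal Q SigmaT r]. *)
Definition Delta_rem Q SigmaT (r : R) : R :=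
  inf [set \tr (Q *m K) | K in rem_feasible SigmaT r].

Definition k_star (sigma q : 'I_k -> R) (nu : R) (i : 'I_k) : R :=
  Num.min (sigma i ^+ 2) (nu / q i).

Definition K_star (U : 'M[R]_k) (sigma q : 'I_k -> R) (nu : R) : 'M[R]_k :=
  U *m diag_mx (\row_i k_star sigma q nu i) *m U^T.

End Model.

(* Main.v *)
(* In the basis given by [U], a feasible [K] has diagonal entries [m_i] with
   [0 < m_i <= sigma_i^2], its cost is [sum_i q_i m_i], and Hadamard's inequality
   turns the rate constraint into [sum_i ln (sigma_i^2 / m_i) <= 2 r].  The
   scalar problem is then solved by Lagrangian duality: adding up the tangent
   inequalities [nu (ln m_i - ln k_i) <= q_i (m_i - k_i)] shows that no
   admissible [m] costs less than the reverse water-filling point [k]. *)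
Require Import Defs.
From HB Require Import structures.
From mathcomp Require Import all_boot all_order all_algebra.
From mathcomp Require Import all_classical all_reals.
From mathcomp Require Import topology normedtype realfun sequences exp ring lra.

Set Implicit Arguments.
Unset Strict Implicit.
Unset Printing Implicit Defensive.

Import Order.TTheory GRing.Theory Num.Theory numFieldNormedType.Exports.
Local Open Scope ring_scope.

(** * Positive definite matrices and Hadamard's inequality *)

Lemma pd_mx_psd (R : realType) (k : nat) (A : 'M[R]_k) : pd_mx A -> psd_mx A.
Proof.
move=> [symA posA]; split=> // x.
have [->|/posA/ltW//] := eqVneq x 0.
by rewrite mulmx0 mxE.
Qed.

Lemma delta_quad (R : realType) (k : nat) (A : 'M[R]_k) (i : 'I_k) :
  ((delta_mx i (0 : 'I_1))^T *m A *m delta_mx i (0 : 'I_1)) 0 0 = A i i.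
Proof. by rewrite trmx_delta -rowE -colE !mxE. Qed.

Lemma pd_mx_diag_gt0 (R : realType) (k : nat) (A : 'M[R]_k) (i : 'I_k) :
  pd_mx A -> 0 < A i i.
Proof.
move=> [_ posA]; rewrite -delta_quad; apply: posA.
apply/eqP => /matrixP/(_ i 0)/eqP.
by rewrite !mxE !eqxx oner_eq0.
Qed.

Lemma psd_mx_diag_ge0 (R : realType) (k : nat) (A : 'M[R]_k) (i : 'I_k) :
  psd_mx A -> 0 <= A i i.
Proof. by move=> [_ posA]; rewrite -delta_quad; apply: posA. Qed.

Lemma pd_mx_congr (R : realType) (k : nat) (A P : 'M[R]_k) :
  P \in unitmx -> pd_mx A -> pd_mx (P^T *m A *m P).
Proof.
move=> uP [symA posA]; split; first by rewrite !trmx_mul trmxK symA mulmxA.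
move=> x x0; have := posA (P *m x); rewrite trmx_mul !mulmxA; apply.
by apply: contra_neq x0 => /(congr1 (mulmx (invmx P))); rewrite mulKmx ?mulmx0.
Qed.

Lemma psd_mx_congr (R : realType) (k : nat) (A P : 'M[R]_k) :
  psd_mx A -> psd_mx (P^T *m A *m P).
Proof.
move=> [symA posA]; split; first by rewrite !trmx_mul trmxK symA mulmxA.
by move=> x; have := posA (P *m x); rewrite trmx_mul !mulmxA.
Qed.

(** For symmetric [A] the inverse is a congruence of [A] by its own inverse. *)
Lemma pd_mx_inv (R : realType) (k : nat) (A : 'M[R]_k) :
  A \in unitmx -> pd_mx A -> pd_mx (invmx A).
Proof.
move=> uA pA; have [symA _] := pA.
have := pd_mx_congr (P := invmx A) _ pA.
by rewrite unitmx_inv trmx_inv symA mulVmx // mul1mx; apply.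
Qed.

Lemma pd_mx_drsub (R : realType) (m n : nat) (A : 'M[R]_(m + n)) :
  pd_mx A -> pd_mx (drsubmx A).
Proof.
move=> [symA posA]; split; first by rewrite trmx_drsub symA.
move=> v v0; have := posA (col_mx 0 v).
rewrite -{1}(submxK A) tr_col_mx trmx0 mul_row_block !mul0mx !add0r mul_row_col.
by rewrite mulmx0 add0r; apply; rewrite col_mx_eq0 negb_and v0 orbT.
Qed.

(* By induction on the size: the determinant is that of the lower right block
   times its Schur complement, which is at most [A 0 0]. *)
Lemma pd_mx_hadamard (R : realType) (k : nat) (A : 'M[R]_k) :
  pd_mx A -> 0 < \det A <= \prod_i A i i.
Proof.
elim: k A => [|k IH] A pA; first by rewrite det_mx00 big_ord0 ltr01 lexx.
change 'M[R]_(1 + k) in A.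
set a := ulsubmx A; set b := ursubmx A; set D := drsubmx A.
have pD : pd_mx D by apply: pd_mx_drsub.
have /andP[D0 Dle] := IH _ pD.
have uD : D \in unitmx by rewrite unitmxE unitfE gt_eqF.
have AE : A = block_mx a b b^T D.
  by rewrite -[LHS]submxK; congr block_mx; rewrite trmx_ursub (proj1 pA).
set y := invmx D *m b^T.
set s := a - b *m y.
have Dy : D *m y = b^T by rewrite mulKVmx.
have detA : \det A = s 0 0 * \det D.
  (* A unit lower triangular factor does not change the determinant; this one clears the lower left
     block and leaves the Schur complement [s] in the corner. *)
  transitivity (\det (A *m block_mx 1%:M 0 (- y) 1%:M)).
    by rewrite det_mulmx det_lblock !det1 !mulr1.
  rewrite [in LHS]AE mulmx_block !mulmx1 !mulmx0 !add0r !mulmxN Dy subrr.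
  by rewrite det_ublock det_mx11.
(* [s] is the value of the quadratic form of [A] at the vector [(1, -y)]. *)
have s0 : 0 < s 0 0.
  have := proj2 (pA : @pd_mx R (1 + k) A) (col_mx 1%:M (- y)).
  rewrite -mulmxA AE mul_block_col !mulmx1 !mulmxN Dy subrr.
  rewrite tr_col_mx mul_row_col mulmx0 addr0 trmx1 mul1mx; apply.
  by rewrite col_mx_eq0 negb_and oner_neq0.
have sle : s 0 0 <= a 0 0.
  rewrite /s !mxE gerBl.
  have [_ /(_ b^T)] := pd_mx_psd (pd_mx_inv uD pD).
  by rewrite trmxK -mulmxA -/y mxE.
rewrite detA mulr_gt0 //= big_ord_recl.
apply: ler_pM (ltW s0) (ltW D0) _ _.
  by rewrite (le_trans sle) // !mxE lshift0.
rewrite (le_trans Dle) // le_eqVlt; apply/orP; left; apply/eqP.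
by apply: eq_bigr => i _; rewrite !mxE rshift1.
Qed.

Lemma psd_mx_diag (R : realType) (k : nat) (d : 'I_k -> R) :
  (forall i, 0 <= d i) -> psd_mx (diag_mx (\row_i d i)).
Proof.
move=> d0; split; first exact: tr_diag_mx.
move=> x; rewrite mul_mx_diag mxE sumr_ge0 // => i _.
by rewrite !mxE mulrAC -expr2 mulr_ge0 // sqr_ge0.
Qed.

Lemma pd_mx_diag (R : realType) (k : nat) (d : 'I_k -> R) :
  (forall i, 0 < d i) -> pd_mx (diag_mx (\row_i d i)).
Proof.
move=> d0; split; first exact: tr_diag_mx.
move=> x x0; rewrite mul_mx_diag mxE.
have F0 i : 0 <= (\matrix_(i, j) (x^T i j * (\row_i d i) 0 j)) 0 i * x i 0.
  by rewrite !mxE mulrAC -expr2 mulr_ge0 ?sqr_ge0 ?ltW.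
rewrite lt_def sumr_ge0 // andbT psumr_neq0 //.
have /cV0Pn[i xi] := x0.
apply/hasP; exists i; rewrite ?mem_index_enum //=.
by rewrite lt_def F0 !mxE !mulf_neq0 // gt_eqF.
Qed.

(** * Logarithms of products and the tangent bound at 1 *)

Lemma ln_prod (R : realType) (I : finType) (F : I -> R) :
  (forall i, 0 < F i) -> ln (\prod_i F i) = \sum_i ln (F i).
Proof.
move=> F0.
(* Positivity of the partial products is carried along, since [lnM] asks for it. *)
suff [] : 0 < \prod_i F i /\ ln (\prod_i F i) = \sum_i ln (F i) by [].
apply: (big_ind2 (fun x y => 0 < x /\ ln x = y)) => [|x1 x2 y1 y2|i _].
- by rewrite ltr01 ln1.
- by move=> [x0 <-] [y0 <-]; rewrite mulr_gt0 // lnM.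
- by [].
Qed.

Lemma ln_le_subr1 (R : realType) (x : R) : 0 < x -> ln x <= x - 1.
Proof. by move=> x0; rewrite -{1}(subrK 1 x) addrC le_ln1Dx //; lra. Qed.

(** * The scalar water-filling problem *)

Section ReverseWaterfilling.
Context (R : realType) (k : nat) (sigma q : 'I_k -> R).
Hypotheses (sigma_gt0 : forall i, 0 < sigma i ^+ 2) (q_gt0 : forall i, 0 < q i).

Lemma k_star_gt0 nu i : 0 < nu -> 0 < k_star sigma q nu i.
Proof. by move=> nu0; rewrite lt_min sigma_gt0 divr_gt0. Qed.

Lemma k_star_le nu i : k_star sigma q nu i <= sigma i ^+ 2.
Proof. by rewrite ge_min lexx. Qed.

(** Concavity of [ln] bounds the left side by [(nu / k) * (m - k)], where [k] is the water-filling
    value. Below the cap [nu / k] equals [q i]; at the cap [nu / k >= q i], but there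
    [m - k <= 0]. *)
Lemma k_star_tangent nu m i : 0 < nu -> 0 < m <= sigma i ^+ 2 ->
  nu * (ln m - ln (k_star sigma q nu i)) <= q i * (m - k_star sigma q nu i).
Proof.
move=> nu0 /andP[m0 mle]; have k0 := k_star_gt0 i nu0.
rewrite -ln_div ?posrE //.
apply: le_trans (_ : nu * (m / k_star sigma q nu i - 1) <= _).
  by rewrite (ler_wpM2l (ltW nu0)) // ln_le_subr1 // divr_gt0.
have -> : m / k_star sigma q nu i - 1
        = (m - k_star sigma q nu i) / k_star sigma q nu i.
  by rewrite mulrBl divff ?gt_eqF.
rewrite mulrCA [leRHS]mulrC.
have [sle|slt] := leP (sigma i ^+ 2) (nu / q i).
  have kE : k_star sigma q nu i = sigma i ^+ 2 by rewrite /k_star min_l.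
  rewrite kE ler_wnM2l ?subr_le0 // ler_pdivlMr // mulrC.
  by rewrite -ler_pdivlMr.
have kE : k_star sigma q nu i = nu / q i by rewrite /k_star min_r // ltW.
by rewrite kE invf_div [nu * (q i / _)]mulrC divfK ?gt_eqF.
Qed.

Lemma k_star_min nu (m : 'I_k -> R) : 0 < nu ->
  (forall i, 0 < m i <= sigma i ^+ 2) ->
  \sum_i ln (k_star sigma q nu i) <= \sum_i ln (m i) ->
  \sum_i q i * k_star sigma q nu i <= \sum_i q i * m i.
Proof.
move=> nu0 mle lnle; rewrite -subr_ge0 -sumrB.
apply: le_trans (_ : \sum_i nu * (ln (m i) - ln (k_star sigma q nu i)) <= _).
  by rewrite -mulr_sumr sumrB mulr_ge0 ?subr_ge0 // ltW.
by apply: ler_sum => i _; rewrite -mulrBr k_star_tangent.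
Qed.

(* In the variable [t = ln nu] the rate is visibly continuous. *)
Lemma ln_div_k_star t i :
  ln (sigma i ^+ 2 / k_star sigma q (expR t) i)
  = Num.max 0 (ln (q i * sigma i ^+ 2) - t).
Proof.
have e0 := expR_gt0 t; have qs0 := mulr_gt0 (q_gt0 i) (sigma_gt0 i).
rewrite -[in RHS](expRK t) -ln_div ?posrE //.
have [sle|slt] := leP (sigma i ^+ 2) (expR t / q i).
  rewrite /k_star min_l // divff ?gt_eqF // ln1 max_l // ln_le0 //.
  by rewrite ler_pdivrMr // mul1r mulrC -ler_pdivlMr.
rewrite /k_star min_r ?(ltW slt) // invf_div mulrA [_ * q i]mulrC max_r //.
by rewrite ln_ge0 // ler_pdivlMr // mul1r mulrC -ler_pdivrMr // ltW.
Qed.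

(** Intermediate value theorem in [t = ln nu], applied to the sum [F] of positive parts. *)
Lemma rate_eq_exists (r : R) : (0 < k)%N -> 0 <= r ->
  exists nu, 0 < nu /\ \sum_i ln (sigma i ^+ 2 / k_star sigma q nu i) = r.
Proof.
move=> k0 r0; pose c i := ln (q i * sigma i ^+ 2).
pose F t : R := \sum_i Num.max 0 (c i - t).
pose i0 := Ordinal k0.
(* At [a] the single term [i0] already contributes [r]; [b] dominates every [c i], so all terms
   vanish there. *)
pose a := c i0 - r; pose b := \sum_i `|c i|.
have cb i : c i <= b.
  by rewrite (le_trans (ler_norm _)) // /b (bigD1 i) //= lerDl sumr_ge0.
have ab : a <= b by rewrite (le_trans _ (cb i0)) // gerBl.
have Fa : r <= F a.
  rewrite /F (bigD1 i0) //= ler_wpDr ?sumr_ge0 // => [i _|].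
    by rewrite le_max lexx.
  by rewrite le_max /a opprB addrCA subrr addr0 lexx orbT.
have Fb : F b = 0.
  by apply: big1 => i _; rewrite max_l // subr_le0.
have cF : continuous F.
  apply: continuous_big => [|i _ t]; first exact: add_continuous.
  apply: (@continuous_max R R (fun=> 0) (fun t => c i - t)).
    exact: cvg_cst.
  by apply: cvgB; [exact: cvg_cst|exact: cvg_id].
have [||t _ Ft] := @IVT R F a b r ab.
- exact: continuous_subspaceT.
- by rewrite Fb ge_min r0 orbT le_max Fa.
exists (expR t); split; first exact: expR_gt0.
by rewrite -Ft; apply: eq_bigr => i _; rewrite ln_div_k_star.
Qed.

(** * Reduction of the matrix problem to the scalar one *)

Context (U SigmaT Q : 'M[R]_k).
Hypothesis U_orth : U^T *m U = 1%:M.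
Hypothesis SigmaT_diag : U^T *m SigmaT *m U = diag_mx (\row_i sigma i ^+ 2).
Hypothesis Q_diag : U^T *m Q *m U = diag_mx (\row_i q i).

Let U_orthT : U *m U^T = 1%:M. Proof. exact: mulmx1C. Qed.

Let U_unit : U \in unitmx. Proof. by case/mulmx1_unit: U_orth. Qed.

Lemma orth_conjK (A D : 'M[R]_k) : U^T *m A *m U = D -> A = U *m D *m U^T.
Proof.
by move=> <-; rewrite !mulmxA U_orthT mul1mx -mulmxA U_orthT mulmx1.
Qed.

Lemma orth_conj_det (A : 'M[R]_k) : \det (U^T *m A *m U) = \det A.
Proof. by rewrite !det_mulmx mulrAC -det_mulmx U_orth det1 mul1r. Qed.

Lemma K_star_conj nu :
  U^T *m K_star U sigma q nu *m U = diag_mx (\row_i k_star sigma q nu i).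
Proof.
by rewrite /K_star !mulmxA U_orth mul1mx -mulmxA U_orth mulmx1.
Qed.

(** By cyclicity of the trace, [K] enters the cost only through its diagonal in the eigenbasis of
    [Q]. *)
Lemma trace_Q (K : 'M[R]_k) : \tr (Q *m K) = \sum_i q i * (U^T *m K *m U) i i.
Proof.
rewrite (orth_conjK Q_diag) -!mulmxA mxtrace_mulC -!mulmxA [U^T *m _]mulmxA.
rewrite mul_diag_mx /mxtrace.
by apply: eq_bigr => i _; rewrite !mxE.
Qed.

Lemma trace_Q_K_star nu :
  \tr (Q *m K_star U sigma q nu) = \sum_i q i * k_star sigma q nu i.
Proof.
by rewrite trace_Q K_star_conj; apply: eq_bigr => i _; rewrite !mxE eqxx.
Qed.

Lemma ln_det_ratio (K : 'M[R]_k) : pd_mx K ->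
  ln (\det SigmaT / \det K)
  = \sum_i ln (sigma i ^+ 2) - ln (\det (U^T *m K *m U)).
Proof.
move=> pK; have /andP[K0 _] := pd_mx_hadamard pK.
have SE : \det SigmaT = \prod_i sigma i ^+ 2.
  rewrite -orth_conj_det SigmaT_diag det_diag.
  by apply: eq_bigr => i _; rewrite mxE.
by rewrite SE ln_div ?posrE ?prodr_gt0 // ln_prod // orth_conj_det.
Qed.

Lemma K_star_optimal nu r : 0 < nu ->
  \sum_i ln (sigma i ^+ 2 / k_star sigma q nu i) = 2 * r ->
  rem_optimal Q SigmaT r (K_star U sigma q nu).
Proof.
move=> nu0; under eq_bigr do rewrite ln_div ?posrE ?k_star_gt0 //.
rewrite sumrB => rate.
have pK : pd_mx (K_star U sigma q nu).
  rewrite /K_star -{1}(trmxK U); apply: pd_mx_congr; first by rewrite unitmx_tr.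
  by apply: pd_mx_diag => i; apply: k_star_gt0.
split; first split => //.
- rewrite /loewner_le (orth_conjK SigmaT_diag) /K_star -mulmxBl -mulmxBr.
  rewrite -linearB -{1}(trmxK U); apply: psd_mx_congr.
  have -> : \row_i sigma i ^+ 2 - \row_i k_star sigma q nu i
          = \row_i (sigma i ^+ 2 - k_star sigma q nu i).
    by apply/rowP => i; rewrite !mxE.
  by apply: psd_mx_diag => i; rewrite subr_ge0 k_star_le.
(* The rate constraint holds with equality. *)
- rewrite ln_det_ratio // K_star_conj det_diag.
  under eq_bigr do rewrite mxE.
  rewrite ln_prod => [|i]; last exact: k_star_gt0.
  by rewrite rate mulKf // pnatr_eq0.
move=> K [pK' leK rK]; rewrite trace_Q_K_star trace_Q.
set M := U^T *m K *m U.
have pM : pd_mx M by apply: pd_mx_congr.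
have M0 i : 0 < M i i by apply: pd_mx_diag_gt0.
apply: k_star_min => // [i|].
  (* The upper bound is nonnegativity of a diagonal entry of the rotated difference [SigmaT - K]. *)
  rewrite M0 -subr_ge0.
  have := psd_mx_diag_ge0 i (psd_mx_congr U leK).
  by rewrite mulmxBr mulmxBl SigmaT_diag !mxE eqxx.
have /andP[dM0 dMle] := pd_mx_hadamard pM.
(* The rate bound on [K] and the rate equation for [nu] give [\sum_i ln k_i <= ln (\det M)];
   Hadamard's inequality extends this to the diagonal entries of [M]. *)
have : ln (\det M) <= \sum_i ln (M i i).
  by rewrite -ln_prod // ler_ln ?posrE ?prodr_gt0.
move: rK; rewrite ln_det_ratio // -/M; lra.
Qed.

Lemma K_star_interior nu : 0 < nu ->
  (forall i, k_star sigma q nu i = nu / q i) ->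
  K_star U sigma q nu = nu *: invmx Q.
Proof.
move=> nu0 kE.
have KQ : K_star U sigma q nu *m Q = nu%:M.
  rewrite (orth_conjK Q_diag) /K_star !mulmxA.
  rewrite -[X in X *m diag_mx _ *m _]mulmxA U_orth mulmx1.
  rewrite -[U *m _ *m _]mulmxA mulmx_diag.
  have -> : \row_i ((\row_i k_star sigma q nu i) 0 i * (\row_i q i) 0 i)
          = const_mx nu.
    by apply/rowP => i; rewrite !mxE kE divfK // gt_eqF.
  rewrite diag_const_mx.
  by rewrite mul_mx_scalar -scalemxAl U_orthT scalemx1.
(* [Q] is a factor of the invertible scalar matrix [nu%:M]. *)
have uQ : Q \in unitmx.
  have : K_star U sigma q nu *m Q \in unitmx.
    by rewrite KQ unitmxE det_scalar unitrX // unitfE gt_eqF.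
  by rewrite unitmx_mul => /andP[].
by rewrite -[LHS](mulmxK uQ) KQ mul_scalar_mx.
Qed.

End ReverseWaterfilling.

(** * The excess distortion and the interior regime *)

(** The optimal [K] shows that the set of costs is nonempty and bounded below, so [inf] is a genuine
    infimum, and it is attained. *)
Lemma Delta_rem_optimal (R : realType) (k : nat) (Q SigmaT K : 'M[R]_k)
    (r : R) :
  rem_optimal Q SigmaT r K -> Delta_rem Q SigmaT r = \tr (Q *m K).
Proof.
move=> [fK minK]; apply/eqP; rewrite eq_le; apply/andP; split.
  by apply: ge_inf; [exists (\tr (Q *m K)) => _ [K' /minK ? <-]|exists K].
by apply: lb_le_inf; [exists (\tr (Q *m K)), K|move=> _ [K' /minK ? <-]].
Qed.

Theorem corollary2 (R : realType) (k : nat) (hk : (1 <= k)%N) (r : R)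
    (hr : 0 <= r) (B SigmaX SigmaV We : 'M[R]_k)
    (hSigmaX : pd_mx SigmaX) (hSigmaV : psd_mx SigmaV) (hWe : pd_mx We)
    (hSigmaT : pd_mx (Sigma_Theta B SigmaX SigmaV))
    (hQ : pd_mx (Q_rem B SigmaX SigmaV We))
    (U : 'M[R]_k) (sigma q : 'I_k -> R)
    (hU : U^T *m U = 1%:M)
    (hUSigma : U^T *m Sigma_Theta B SigmaX SigmaV *m U =
               diag_mx (\row_i sigma i ^+ 2))
    (hUQ : U^T *m Q_rem B SigmaX SigmaV We *m U = diag_mx (\row_i q i))
    (hq : forall i, 0 < q i) :
  let SigmaT := Sigma_Theta B SigmaX SigmaV in
  let Q := Q_rem B SigmaX SigmaV We in
  let rate_eq nu :=
    \sum_(i < k) ln (sigma i ^+ 2 / k_star sigma q nu i) = 2 * r in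
  (exists nu : R, 0 < nu /\ rate_eq nu) /\
  forall nu : R, 0 < nu -> rate_eq nu ->
    [/\ rem_optimal Q SigmaT r (K_star U sigma q nu),
        Delta_rem Q SigmaT r = \tr (Q *m K_star U sigma q nu)
      & (forall i, k_star sigma q nu i < sigma i ^+ 2) ->
        [/\ K_star U sigma q nu = nu *: invmx Q,
            nu = expR (k%:R^-1 *
                   ((\sum_(i < k) ln (q i * sigma i ^+ 2)) - 2 * r)),
            Delta_rem Q SigmaT r = \tr (Q *m K_star U sigma q nu)
          & \tr (Q *m K_star U sigma q nu) = k%:R * nu]].
Proof.
move=> SigmaT Q rate_eq.
(* These are the diagonal entries of a congruence of the positive definite [SigmaT]. *)
have s0 i : 0 < sigma i ^+ 2.
  have uU : U \in unitmx by case/mulmx1_unit: hU.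
  have := pd_mx_diag_gt0 i (pd_mx_congr uU hSigmaT).
  by rewrite hUSigma !mxE eqxx.
split; first by apply: rate_eq_exists => //; rewrite mulr_ge0.
move=> nu nu0 rate.
have optK := K_star_optimal s0 hq hU hUSigma hUQ nu0 rate.
have DK := Delta_rem_optimal optK.
split=> // klt.
have kE i : k_star sigma q nu i = nu / q i.
  by have := klt i; rewrite /k_star gt_min ltxx => /ltW/min_r.
split=> //; first exact: K_star_interior.
- have k0 : k%:R != 0 :> R by rewrite pnatr_eq0 -lt0n.
  (* After taking logarithms and multiplying by [k], the identity holds term by term: [ln (q_i s_i)
     - ln (s_i / k_i) = ln (q_i k_i) = ln nu], with [s_i] the variance [sigma i ^+ 2]. *)
  rewrite -{1}(lnK nu0); congr expR; apply: (mulfI k0); rewrite mulVKf //.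
  rewrite -rate -sumrB -[k in LHS]card_ord mulr_natl -sumr_const.
  apply: eq_bigr => i _.
  rewrite kE; move: (sigma i ^+ 2) (s0 i) (hq i) => s si0 qi0.
  rewrite -ln_div ?posrE; [congr ln|exact: mulr_gt0|by rewrite !divr_gt0].
  by field; rewrite !gt_eqF.
- rewrite (trace_Q_K_star sigma hU hUQ).
  under eq_bigr do rewrite kE mulrC divfK ?gt_eqF //.
  by rewrite sumr_const card_ord mulr_natl.
Qed.
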